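(* In the continuous model, let $\mathcal G_l=(V_l,\mathcal E_l)$ be the virtual graph corresponding to any regular recursively generated graph (RRGG) $G_l=(V_l,E_l)$ with $G_0=(V_0,E_0)=C_n$ as base graph and $\mathcal P=\{C_n\}$. If $|D|=1$ and $D_{i,j}\in\{0,1\}$ for all $i,j\in V_l$, then for any source-destination pair $s,e$ the latencies of the modified greedy, local best effort and NoN local best effort routing algorithms are upper bounded by $$O\left(\left(\frac n2\right)^{l+1}\right).$$
   Context: $\mathrm{dist}_G$ and $\mathrm{diam}_G$ denote hop distance and diameter of a graph $G$. $C_n$ is the cycle on nodes $\{0,\dots,n-1\}$, with $n=2^m$; $d_{\mathrm{th}}=2^r$ is a threshold distance ($r\le m$ positive integers). Edge substitution of a graph $G$ with respect to a graph $H$: each edge $(u,v)$ of $G$ is deleted and replaced by a copy $G_{uv}$ of $H$, containing nodes $w_{uv},w'_{uv}$ with $\mathrm{dist}_{G_{uv}}(w_{uv},w'_{uv})=\mathrm{diam}_H$, together with the edges $(u,w_{uv})$ and $(v,w'_{uv})$. RRGG with $G_0=H=C_n$ and $\mathcal P=\{C_n\}$: start from $G_0=C_n$; given $G_l$, every subgraph of $G_l\setminus G_{l-1}$ (the part of $G_l$ newly created at step $l$; all of $G_0$ when $l=0$) that is isomorphic to $C_n$ undergoes edge substitution with respect to $C_n$, and the result is $G_{l+1}$; all other edges are kept. Recursively generated virtual graph. $\mathcal G_0=(V_0,\mathcal E_0)$ is $C_n$ with virtual edges added, joining nodes at distance at most $d_{\mathrm{th}}$ in $C_n$, in one of these ways.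 Deterministic: a node $x=2^iy$ ($i,y$ non-negative integers, $y$ odd or $0$) has virtual neighbours $x\pm2^j\bmod n$, $1\le j\le\min(i,\log_2d_{\mathrm{th}})$. Random: each node chooses $\log_2 d_{\mathrm{th}}$ virtual neighbours independently without replacement among nodes within distance $d_{\mathrm{th}}$, with probability proportional to the inverse distance (power-law) or uniformly. For $l\ge1$, every subgraph $\tilde G_{l-1}\subseteq G_{l-1}\setminus G_{l-2}$ isomorphic to $C_n$ undergoes edge substitution with respect to $\mathcal G_0$; if $\tilde{\mathcal E}_l$ denotes the edge set of the substituted graph, then $\mathcal E_l=\mathcal E_{l-1}\cup\bigcup_{\tilde G_{l-1}}\tilde{\mathcal E}_l$. Continuous model. Neighbours in $\mathcal G_l$ pre-share entangled links ($cap\ge1$ per pair), available when the demand arrives. $\mathcal G(u,v)$ is the number of available links between $u$ and $v$, and $\mathrm{Neigh}_{\mathcal G}(u)$ the set of neighbours of $u$ in the virtual graph. $D$ is the demand matrix ($D_{i,j}$ is the number of entangled links requested between $i$ and $j$), $|D|$ its number of nonzero entries. Time is discrete, one time step being the communication time between two neighbouring nodes of the physical graph $G_l$. The latency of a demand is the number of time steps an algorithm takes to distribute the requested links between source and destination; entanglement swaps are deterministic and take negligible time. Algorithms (physical graph $G_{\mathrm{ph}}=G_l$, virtual graph $\mathcal G=\mathcal G_l$). Each discovers a path from $s$ to $e$ hop by hop, starting with $u_{\mathrm{curr}}=s$ and running while $u_{\mathrm{curr}}\ne e$, reserving links along it; then the intermediate nodes perform entanglement swaps. ''Closest'' refers to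 $\mathrm{dist}_{G_{\mathrm{ph}}}$, ''physical neighbour'' to neighbours in $G_{\mathrm{ph}}$. - Modified greedy: let $u$ be the node of $\mathrm{Neigh}_{\mathcal G}(u_{\mathrm{curr}})$ closest to $e$. If there are not enough links available between $u$ and $u_{\mathrm{curr}}$ for the demand $D_{s,e}$, and $\mathrm{dist}_{G_{\mathrm{ph}}}(u_{\mathrm{curr}},e)<\mathrm{dist}_{G_{\mathrm{ph}}}(u_{\mathrm{curr}},u)+\mathrm{dist}_{G_{\mathrm{ph}}}(u,e)$, replace $u$ by the physical neighbour of $u_{\mathrm{curr}}$ closest to $e$. Append $u$ to the path and set $u_{\mathrm{curr}}=u$. - Local best effort: let $u$ be the node closest to $e$ among the $v\in\mathrm{Neigh}_{\mathcal G}(u_{\mathrm{curr}})$ with $\mathcal G(v,u_{\mathrm{curr}})\ge D_{s,e}$. If no such $u$ exists or $u$ is not strictly closer to $e$ than $u_{\mathrm{curr}}$, let $u$ be the physical neighbour of $u_{\mathrm{curr}}$ closest to $e$. Append $u$ and set $u_{\mathrm{curr}}=u$. - NoN local best effort (nodes also know the neighbours of their neighbours): initially put $d=\mathrm{dist}_{G_{\mathrm{ph}}}(s,e)$. At each step let $U'=\{u'\in\mathrm{Neigh}_{\mathcal G}(u_{\mathrm{curr}}):\mathcal G(u_{\mathrm{curr}},u')\ge D_{s,e}\}$. For every $u'\in U'$: let $u$ be the node closest to $e$ among the $v\in\mathrm{Neigh}_{\mathcal G}(u')$ with $\mathcal G(v,u')\ge D_{s,e}$; if no such $u$ exists or $\mathrm{dist}_{G_{\mathrm{ph}}}(u_{\mathrm{curr}},e)<\mathrm{dist}_{G_{\mathrm{ph}}}(u,e)$,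 let $u$ be the physical neighbour of $u_{\mathrm{curr}}$ closest to $e$; if $\mathrm{dist}_{G_{\mathrm{ph}}}(u,e)<d$, set $d=\mathrm{dist}_{G_{\mathrm{ph}}}(u,e)$ and $u_{\mathrm{next}}=u'$. If $U'=\emptyset$, carry out the same loop with $u'$ ranging over the physical neighbours of $u_{\mathrm{curr}}$. Append $u_{\mathrm{next}}$ and set $u_{\mathrm{curr}}=u_{\mathrm{next}}$.
   Formalization: The NoN algorithm as described can stall forever once d=0; here, whenever a pass of its loop assigns no u_next, the next node is chosen by the local best effort rule. The O-constant may depend on l and d_th. *)

(* Defs.v *)
From HB Require Import structures.
From mathcomp Require Import all_boot all_order all_algebra.
Set Implicit Arguments.
Unset Strict Implicit.
Unset Printing Implicit Defensive.
Import Order.TTheory GRing.Theory Num.Theory.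

Section Graphs.
Variable T : finType.

(* Undirected graphs. An edge is the set of its two endpoints; singletons that
   may occur in [edges] are ignored by [adj]. *)
Record graph := Graph { nodes : {set T}; edges : {set {set T}} }.

Definition adj (G : graph) : rel T :=
  fun x y => (x != y) && ([set x; y] \in edges G).

Definition neigh (G : graph) (x : T) : {set T} := [set y | adj G x y].

Definition has_walk (G : graph) (x y : T) (k : nat) : bool :=
  [exists p : k.-tuple T, path (adj G) x p && (last x p == y)].

(* Hop distance: the least length of a walk, and #|T| when there is none (a
   shortest walk repeats no vertex, hence has length < #|T|). *)
Definition dist (G : graph) (x y : T) : nat :=
  find (has_walk G x y) (iota 0 #|T|).

Definition diam (G : graph) : nat :=
  \max_(x in nodes G) \max_(y in nodes G) dist G x y.

End Graphs.

Definition cycle_graph (n : nat) : graph 'I_n :=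
  Graph [set: 'I_n] [set [set i; ordS i] | i : 'I_n].

Definition image_edges (K T : finType) (c : K -> T) (E : {set {set K}}) :
  {set {set T}} := [set c @: f | f : {set K} in E].

(* Edge sets of the subgraphs of the graph with edge set F that are isomorphic
   to P (P without isolated nodes). *)
Definition copies_in (K T : finType) (P : graph K) (F : {set {set T}}) :
  {set {set {set T}}} :=
  [set image_edges c (edges P) | c : {ffun K -> T} &
     injectiveb c && (image_edges c (edges P) \subset F)].

Section EdgeSubstitution.
Variables (T K : finType).
(* The copy of the substituting graph that replaces the edge f = {u, v} is the
   image of [copy f]. The endpoints u and v are attached to its nodes
   w_uv = copy f (port f u) and w'_uv = copy f (port f v). *)
Variables (copy : {set T} -> K -> T) (port : {set T} -> T -> K).

Definition subst_edges (H : graph K) (S : {set {set T}}) : {set {set T}} :=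
  \bigcup_(f in S) (image_edges (copy f) (edges H) :|:
                    [set [set u; copy f (port f u)] | u : T in f]).

Definition edge_subst (H : graph K) (S : {set {set T}}) (G : graph T) :
  graph T :=
  Graph (nodes G :|: \bigcup_(f in S) copy f @: nodes H)
        (edges G :\: S :|: subst_edges H S).

Record valid_subst (H : graph K) (S : {set {set T}}) (G : graph T) : Prop := {
  copy_inj : forall f, f \in S -> injective (copy f);
  copy_new : forall f x, f \in S -> copy f x \notin nodes G;
  copy_disj : forall f g x y, f \in S -> g \in S -> f != g ->
    copy f x != copy g y;
  port_diam : forall f u v, f \in S -> u \in f -> v \in f -> u != v ->
    dist H (port f u) (port f v) = diam H
}.

End EdgeSubstitution.

Section Recursive.
Variables (T : finType) (n : nat).

Definition new_edges (G : nat -> graph T) (k : nat) : {set {set T}} :=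
  if k is k'.+1 then edges (G k) :\: edges (G k') else edges (G k).

Definition subst_set (G : nat -> graph T) (k : nat) : {set {set T}} :=
  cover (copies_in (cycle_graph n) (new_edges G k)).

Variables (base : 'I_n -> T) (copy : nat -> {set T} -> 'I_n -> T)
          (port : nat -> {set T} -> T -> 'I_n).

(* G 0, ..., G l are the first l+1 stages; [base] places C_n in the ambient
   type T, [copy k] and [port k] are the data of the (k+1)-st substitution. *)
Record rrgg (l : nat) (G : nat -> graph T) : Prop := {
  base_inj : injective base;
  rrgg0 : G 0 = Graph (base @: nodes (cycle_graph n))
                      (image_edges base (edges (cycle_graph n)));
  rrgg_valid : forall k, k < l ->
    valid_subst (copy k) (port k) (cycle_graph n) (subst_set G k) (G k);
  rrggS : forall k, k < l ->
    G k.+1 = edge_subst (copy k) (port k) (cycle_graph n) (subst_set G k) (G k)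
}.

(* Virtual edges: the substitution is made with respect to VG0, a graph on the
   nodes of C_n, in the same copies and with the same attachment nodes as in
   the physical graph, and the earlier edges are all kept. *)
Fixpoint virtual_edges (VG0 : graph 'I_n) (G : nat -> graph T) (l : nat) :
  {set {set T}} :=
  if l is k.+1 then
    virtual_edges VG0 G k :|: subst_edges (copy k) (port k) VG0 (subst_set G k)
  else image_edges base (edges VG0).

Definition virtual_graph (VG0 : graph 'I_n) (G : nat -> graph T) (l : nat) :
  graph T := Graph (nodes (G l)) (virtual_edges VG0 G l).

End Recursive.

(* C_n together with an edge from each node x to its virtual neighbours L x. *)
Definition base_virtual_graph (n : nat) (L : 'I_n -> {set 'I_n}) : graph 'I_n :=
  Graph [set: 'I_n]
    (edges (cycle_graph n) :|: [set [set x; z] | x in [set: 'I_n], z in L x]).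

(* Here and below n = 2^m and the threshold distance is 2^r.
   z = x - 2^j mod n is expressed as x = z + 2^j mod n; z != x discards
   x + 2^j = x mod n, which happens for j = m. *)
Definition deterministic_links (m r : nat) (L : 'I_(2 ^ m) -> {set 'I_(2 ^ m)}) :
  Prop :=
  forall x z, z \in L x <->
    z != x /\
    exists i y j : nat,
      [/\ x = 2 ^ i * y :> nat, odd y \/ y = 0, 1 <= j <= minn i r
        & z = x + 2 ^ j %[mod 2 ^ m] \/ x = z + 2 ^ j %[mod 2 ^ m]].

Section RandomLinks.
Local Open Scope ring_scope.

(* Probability of drawing the sequence t from A without replacement, each draw
   being made with probability proportional to the weight w. *)
Fixpoint draw_prob (K : finType) (w : K -> rat) (A : {set K}) (t : seq K) :
  rat :=
  if t is y :: t' then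
    if y \in A then w y / (\sum_(z in A) w z) * draw_prob w (A :\ y) t' else 0
  else 1.

Variables (m r : nat).
Let n := (2 ^ m)%N.

Definition in_range (x : 'I_n) : {set 'I_n} :=
  [set z | (z != x) && (dist (cycle_graph n) x z <= 2 ^ r)%N].

(* Joint probability of the independent draws of all the nodes. *)
Definition choice_prob (w : 'I_n -> 'I_n -> rat)
    (t : {ffun 'I_n -> r.-tuple 'I_n}) : rat :=
  \prod_(x : 'I_n) draw_prob (w x) (in_range x) (t x).

Definition power_law_weight (x z : 'I_n) : rat :=
  ((dist (cycle_graph n) x z)%:R)^-1.

Definition uniform_weight (x z : 'I_n) : rat := 1.

(* L is an outcome of positive probability: what holds for all such L holds
   almost surely. *)
Definition random_links (w : 'I_n -> 'I_n -> rat) (L : 'I_n -> {set 'I_n}) :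
  Prop :=
  exists2 t : {ffun 'I_n -> r.-tuple 'I_n},
    0 < choice_prob w t & forall x, L x = [set z in t x].

End RandomLinks.

Inductive strategy := Deterministic | PowerLaw | Uniform.

Definition links_from (sg : strategy) (m r : nat)
    (L : 'I_(2 ^ m) -> {set 'I_(2 ^ m)}) : Prop :=
  match sg with
  | Deterministic => deterministic_links r L
  | PowerLaw => random_links r (@power_law_weight m) L
  | Uniform => random_links r (@uniform_weight m) L
  end.

Section Routing.
Variable T : finType.

(* [links x y] is the number of available links between x and y; [clock] counts
   the elapsed time steps; [best] is the variable d of the NoN algorithm. *)
Record state := State {
  curr : T; links : T -> T -> nat; clock : nat; best : nat }.

Variables (Gph VG : graph T) (q : nat) (e : T).

(* v is one of the nodes of A closest to e. *)
Definition closest (A : {set T}) (v : T) : bool :=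
  (v \in A) && [forall w in A, dist Gph v e <= dist Gph w e].

(* Virtual neighbours of x sharing at least q available links with x. *)
Definition avail_neigh (st : state) (x : T) : {set T} :=
  [set v in neigh VG x | q <= links st v x].

(* The relations [.._next st u d]: from state st the algorithm may select u as
   next node, the variable d taking the given value. All ties are broken
   arbitrarily. *)

Definition greedy_next (st : state) (u : T) (d : nat) : Prop :=
  d = best st /\
  exists2 u0, closest (neigh VG (curr st)) u0 &
    if (links st u0 (curr st) < q) &&
       (dist Gph (curr st) e < dist Gph (curr st) u0 + dist Gph u0 e)
    then closest (neigh Gph (curr st)) u
    else u == u0.

Definition best_effort_choice (st : state) (u : T) : bool :=
  let good := [set v | closest (avail_neigh st (curr st)) v &
                       dist Gph v e < dist Gph (curr st) e] in
  if good == set0 then closest (neigh Gph (curr st)) u else u \in good.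

Definition best_effort_next (st : state) (u : T) (d : nat) : Prop :=
  d = best st /\ best_effort_choice st u.

(* The node u examined by the NoN algorithm for the candidate u'. Only its
   distance to e is used, so the choice among equally close nodes is
   immaterial. *)
Definition lookahead (st : state) (u' : T) : option T :=
  let phys := [pick p | closest (neigh Gph (curr st)) p] in
  if [pick v | closest (avail_neigh st u') v] is Some v then
    if dist Gph (curr st) e < dist Gph v e then phys else Some v
  else phys.

Definition non_loop (st : state) (order : seq T) : nat * option T :=
  foldl (fun (acc : nat * option T) u' =>
           if lookahead st u' is Some u then
             if dist Gph u e < acc.1 then (dist Gph u e, Some u') else acc
           else acc)
        (best st, None) order.

Definition non_candidates (st : state) : {set T} :=
  if avail_neigh st (curr st) == set0 then neigh Gph (curr st)
  else avail_neigh st (curr st).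

(* The candidates are examined in an arbitrary order. A pass of the loop that
   improves on d for no candidate leaves the next node unassigned (as is always
   the case once d = 0, i.e. once e has been seen among the neighbours of the
   current node); the next node is then the one of local best effort. *)
Definition non_next (st : state) (u : T) (d : nat) : Prop :=
  exists2 order : seq T, perm_eq order (enum (non_candidates st)) &
    let: (d', next) := non_loop st order in
    d = d' /\
    if next is Some u' then u = u' else best_effort_choice st u.

Definition reserve (c : T -> T -> nat) (x y : T) : T -> T -> nat :=
  fun a b => if [set a; b] == [set x; y] then c a b - q else c a b.

(* The hop x -> u costs the time for a message to travel from x to u in the
   physical graph. *)
Definition hop (st : state) (u : T) (d : nat) : state :=
  State u (reserve (links st) (curr st) u)
        (clock st + dist Gph (curr st) u) d.

(* Every execution from st, whatever the arbitrary choices, reserves q links on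
   each of its hops and reaches e after at most B time steps on the clock. *)
Inductive latency_le (next : state -> T -> nat -> Prop) (B : nat) :
  state -> Prop :=
| latency_done st : curr st = e -> clock st <= B -> latency_le next B st
| latency_hop st : curr st <> e ->
    (exists u d, next st u d) ->
    (forall u d, next st u d ->
       q <= links st (curr st) u /\ latency_le next B (hop st u d)) ->
    latency_le next B st.

End Routing.

Inductive algorithm := ModifiedGreedy | LocalBestEffort | NoNLocalBestEffort.

Definition next_of (a : algorithm) :=
  match a with
  | ModifiedGreedy => greedy_next
  | LocalBestEffort => best_effort_next
  | NoNLocalBestEffort => non_next
  end.

(* Each pair of virtual neighbours initially shares cap links. *)
Definition initial_state (T : finType) (Gph VG : graph T) (cap : nat)
    (s e : T) : state T :=
  State s (fun x y => if adj VG x y then cap else 0) 0 (dist Gph s e).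

Definition latency_at_most (T : finType) (a : algorithm) (Gph VG : graph T)
    (cap : nat) (D : T -> T -> nat) (s e : T) (B : nat) : Prop :=
  latency_le Gph (D s e) e (@next_of a T Gph VG (D s e) e) B
    (initial_state Gph VG cap s e).

(* Main.v *)
Require Import Defs.
From mathcomp Require Import all_boot all_order all_algebra.
From mathcomp Require Import zify.

(* A gadget is the set of all nodes that are created, directly or recursively, by
   the substitution of one edge f = {u, v}.  In the virtual graph it can be left
   only through u and v, and u and v remain virtual neighbours because the
   earlier edges are kept.  Hence a node inside a gadget that does not contain
   the destination e is never a better choice than u or v, and none of the
   three algorithms enters such a gadget.  So only the base cycle and, for each
   step, the two cycles whose gadgets contain e or the start can be visited: at
   most (2l + 1) n nodes.  Modified greedy and local best effort decrease the
   distance to e at each hop; for NoN, after the first hop, the variable d is the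
   least distance to e over the virtual neighbours of the current node, and it
   decreases until it vanishes.  In both cases no node is visited twice (for NoN,
   after the first hop), so there are at most (2l + 1) n + 2 hops, and a link
   already used is never needed again.  Finally each virtual link spans at most 2^r edges of some cycle, hence
   a distance at most 2^r (n/2 + 2)^l in G_l. *)

Set Implicit Arguments.
Unset Strict Implicit.
Unset Printing Implicit Defensive.
Import GRing.Theory Num.Theory.

(** * Walks of bounded length and hop distance *)

Section Walks.
Variables (T : finType) (G : graph T).
Implicit Types x y z : T.

Lemma adj_sym x y : adj G x y = adj G y x.
Proof. by rewrite /adj eq_sym setUC. Qed.

(** Since [dist] takes a default value on unconnected pairs, bounds on distance are carried by
    explicit walks, which can be concatenated, reversed and mapped. *)
Definition walk_le (t : nat) x y : Prop :=
  exists p, [/\ path (adj G) x p, last x p = y & size p <= t].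

Lemma has_walkP x y k :
  reflect (exists p, [/\ path (adj G) x p, last x p = y & size p = k])
          (has_walk G x y k).
Proof.
apply: (iffP existsP) => [[p /andP[xp /eqP py]]|[p [xp py sp]]].
  by exists p; rewrite size_tuple.
have/eqP sp' := sp.
by exists (Tuple sp'); rewrite /= xp py eqxx.
Qed.

Lemma dist_le_card x y : dist G x y <= #|T|.
Proof. by rewrite /dist -[leqRHS](size_iota 0) find_size. Qed.

(** A walk of length below [#|T|] lies in the range searched by [find]; for a longer one the default
    bound [#|T|] suffices. *)
Lemma dist_le_walk t x y : walk_le t x y -> dist G x y <= t.
Proof.
case=> p [xp py spt]; apply: leq_trans spt.
have [szp|] := ltnP (size p) #|T|; last exact: leq_trans (dist_le_card _ _).
rewrite leqNgt; apply/negP => /(before_find 0).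
by rewrite nth_iota // add0n => /has_walkP[]; exists p.
Qed.

(** Removing repeated vertices makes the walk shorter than [#|T|], so the search defining [dist]
    succeeds. *)
Lemma walk_le_dist t x y : walk_le t x y -> walk_le (dist G x y) x y.
Proof.
case=> p [xp py _]; case/shortenP: xp py => p' xp' up' _ py'.
have szp' : size p' < #|T|.
  by have := max_card [in x :: p']; rewrite (card_uniqP up').
have hw : has (has_walk G x y) (iota 0 #|T|).
  apply/hasP; exists (size p'); first by rewrite mem_iota.
  by apply/has_walkP; exists p'.
have := nth_find 0 hw; rewrite nth_iota; last first.
  by move: hw; rewrite has_find size_iota.
by case/has_walkP=> q [xq qy sq]; exists q; rewrite sq.
Qed.

Lemma walk_le0 x : walk_le 0 x x. Proof. by exists [::]. Qed.

Lemma walk_le1 x y : adj G x y -> walk_le 1 x y.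
Proof. by move=> xy; exists [:: y]; rewrite /= xy. Qed.

Lemma walk_leW s t x y : s <= t -> walk_le s x y -> walk_le t x y.
Proof. by move=> st [p [? ? ps]]; exists p; split=> //; apply: leq_trans st. Qed.

Lemma walk_le_trans s t x y z :
  walk_le s x y -> walk_le t y z -> walk_le (s + t) x z.
Proof.
case=> p [xp py ps] [q [yq qz qt]]; exists (p ++ q).
by rewrite cat_path last_cat py xp yq size_cat leq_add.
Qed.

Lemma walk_le_sym t x y : walk_le t x y -> walk_le t y x.
Proof.
case=> p [xp <- pt]; exists (rev (belast x p)).
rewrite size_rev size_belast rev_path; split=> //.
- by rewrite (eq_path (e' := adj G)) // => u v; rewrite adj_sym.
- by case: p {xp pt} => //= y' p; rewrite rev_cons last_rcons.
Qed.

Lemma distxx x : dist G x x = 0.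
Proof. by apply/eqP; rewrite -leqn0; apply/dist_le_walk/walk_le0. Qed.

Lemma dist_eq0 x y : dist G x y = 0 -> x = y.
Proof.
rewrite /dist; have := max_card (pred1 x); rewrite card1.
case: #|T| => //= k _; case: ifP => // /has_walkP[p [_ <- /size0nil->]] //.
Qed.

Lemma dist_step t x y : walk_le t x y -> x != y ->
  exists2 z, adj G x z & dist G z y < dist G x y.
Proof.
move=> /walk_le_dist[[|z p] /= [xp py sp] xy]; first by rewrite py eqxx in xy.
case/andP: xp => xz zp; exists z => //.
by apply: leq_trans sp; rewrite ltnS; apply: dist_le_walk; exists p.
Qed.

Lemma closest_ex e (A : {set T}) x : x \in A -> exists v, closest G e A v.
Proof.
move=> xA; case: (arg_minnP (fun v => dist G v e) xA) => v vA vmin.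
by exists v; apply/andP; split=> //; apply/forall_inP.
Qed.

Lemma closest_in e (A : {set T}) v : closest G e A v -> v \in A.
Proof. by case/andP. Qed.

Lemma closest_le e (A : {set T}) v w :
  closest G e A v -> w \in A -> dist G v e <= dist G w e.
Proof. by case/andP=> _ /forall_inP; apply. Qed.

End Walks.

(** Used with [s = 1] to embed a cycle, and with [h] the identity to follow a walk through a
    substitution that stretches its edges. *)
Lemma walk_le_sub (T U : finType) (G : graph T) (H : graph U) (h : T -> U)
    s t x y :
  (forall a b, adj G a b -> walk_le H s (h a) (h b)) ->
  walk_le G t x y -> walk_le H (s * t) (h x) (h y).
Proof.
move=> GH [p [xp <- pt]]; elim: p x t xp pt => [|z p IHp] x [|t] //=.
- by move=> *; exists [::].
- by move=> *; exists [::].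
case/andP=> /GH xz /IHp{}IHp /IHp zp; rewrite mulnS.
exact: walk_le_trans xz zp.
Qed.

(** * Routing in a virtual graph with closed-off parts *)

Section Routing.
Variables (T : finType) (Gph VG : graph T) (q : nat) (e : T) (V : {set T}).
Variable W : nat.
Hypothesis adj_VG : forall x y, adj Gph x y -> adj VG x y.
Hypothesis VG_nodes : forall x y, adj VG x y -> y \in V.
Hypothesis closer : forall x, x \in V -> x != e ->
  exists2 y, adj Gph x y & dist Gph y e < dist Gph x e.
Hypothesis VG_dist : forall x y, adj VG x y -> dist Gph x y <= W.

Local Notation dst x := (dist Gph x e).
Local Notation next_rel := (state T -> T -> nat -> Prop).

(** [A] abstracts a gadget and [f] the edge it replaces: the only way out of [A] is through [f], and
    nodes of [f] see each other. *)
Definition gate (A f : {set T}) : Prop :=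
  (forall x y, adj VG x y -> y \in A -> x \in A \/ x \in f) /\
  (forall x y, x \in f -> y \in f -> x = y \/ adj VG x y).

Definition sheltered (X : {set T}) : Prop :=
  forall x y, x \in X -> y \notin X -> adj VG x y ->
  exists A f, [/\ gate A f, y \in A, x \notin A & e \notin A].

(** Physical hops that approach [e] must eventually leave [A], and the first node outside [A]
    belongs to [f]. *)
Lemma gate_exit A f z : gate A f -> e \notin A -> z \in V -> z \in A ->
  exists2 b, b \in f & dst b < dst z.
Proof.
move=> [Af _] eA; have [k] := ubnP (dst z).
elim: k z => // k IHk z zk zV zA.
have [|y zy yz] := closer zV; first by apply: contraNneq eA => <-.
have yz' : adj VG y z by rewrite adj_sym adj_VG.
have [yA|yf] := Af _ _ yz' zA; last by exists y.
have [|b bf by'] := IHk y _ (VG_nodes (adj_VG zy)) yA.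
  by apply: leq_trans yz _.
by exists b => //; apply: ltn_trans yz.
Qed.

(* Entering a part closed off by a gate cannot help: whatever is seen from
   inside is at least as far from e as something already seen from x. *)
Lemma sheltered_exit X x y : sheltered X -> x \in X -> y \notin X ->
  adj VG x y ->
  (exists2 b, b = x \/ adj VG x b & dst b < dst y) /\
  (forall z, adj VG y z -> exists2 b, b = x \/ adj VG x b & dst b <= dst z).
Proof.
move=> sX xX yX xy; have [A [f [[Af ff] yA xA eA]]] := sX x y xX yX xy.
have xf : x \in f.
  by case: (Af x y xy yA) => // xA'; rewrite xA' in xA.
have near b : b \in f -> b = x \/ adj VG x b.
  by move=> bf; case: (ff _ _ xf bf) => [->|]; [left|right].
have in_exit z : z \in V -> z \in A ->
    exists2 b, b = x \/ adj VG x b & dst b < dst z.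
  move=> zV zA; have [b bf bz] := gate_exit (conj Af ff) eA zV zA.
  by exists b => //; apply: near.
split; first exact: in_exit (VG_nodes xy) yA.
move=> z yz; have zy : adj VG z y by rewrite adj_sym.
have [zA|zf] := Af z y zy yA.
  by have [b xb /ltnW bz] := in_exit z (VG_nodes yz) zA; exists b.
by exists z => //; apply: near.
Qed.

(** * Link consumption and the two distance-decreasing algorithms *)

Lemma avail_neighP (st : state T) x v :
  reflect (adj VG x v /\ q <= links st v x) (v \in avail_neigh VG q st x).
Proof. by rewrite !inE; apply: andP. Qed.

Lemma reserveN (c : T -> T -> nat) x y a b :
  a != x -> a != y -> reserve q c x y a b = c a b.
Proof.
move=> ax ay; rewrite /reserve ifN //; apply: contraTneq isT => /setP/(_ a).
by rewrite !inE eqxx (negPf ax) (negPf ay).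
Qed.


(* The links at nodes closer to e than d are plentiful: hops have so far only
   used pairs of nodes at distance at least d. *)
Definition spare (st : state T) (d : nat) : Prop :=
  (forall x y, links st x y = links st y x) /\
  (forall x y, adj VG x y -> dst x < d -> q <= links st x y).

Lemma spare_hop st u b d d' : spare st d -> d' <= d ->
  d' <= dst (curr st) -> d' <= dst u -> spare (hop Gph q st u b) d'.
Proof.
move=> [sym free] d'd d'c d'u; split=> [x y|x y xy xd'] /=.
  by rewrite /reserve [[set y; x]]setUC sym.
have far z : d' <= dst z -> x != z.
  by apply: contraTneq => <-; rewrite -ltnNge.
by rewrite reserveN ?far // free // (leq_trans xd').
Qed.

(** The potential is the number of nodes of [X] closer to [e] than the current one. Each hop costs
    at most [W] and moves closer to [e], so the potential drops. The run stays in [X]: by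
    [sheltered_exit], a neighbour outside [X] is beaten by the current node or by another of its
    neighbours, so it is never a closest one. *)
Lemma greedy_like_latency (next : next_rel) B X st :
  (forall st, spare st (dst (curr st)) -> curr st \in V -> curr st != e ->
     (exists u d, next st u d) /\
     (forall u d, next st u d -> closest Gph e (neigh VG (curr st)) u)) ->
  sheltered X -> spare st (dst (curr st)) -> curr st \in V -> curr st \in X ->
  clock st + W * #|[set y in X | dst y < dst (curr st)]| <= B ->
  latency_le Gph q e next B st.
Proof.
move=> nextP sX; have [k] := ubnP #|[set y in X | dst y < dst (curr st)]|.
elim: k st => // k IHk st ltXk free cV cX timeB.
have [ce|ce] := eqVneq (curr st) e.
  by apply: latency_done => //; apply: leq_trans timeB; apply: leq_addr.
have [ex_next next_closest] := nextP st free cV ce.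
apply: latency_hop => // [|u d /next_closest uP]; first exact/eqP.
have cu : adj VG (curr st) u by have := closest_in uP; rewrite inE.
have [p cp pc] := closer cV ce.
have uc : dst u < dst (curr st).
  by apply: leq_ltn_trans pc; apply: closest_le uP _; rewrite inE adj_VG.
have uX : u \in X.
  case: (boolP (u \in X)) => // uX.
  have [[b [->|cb] bu] _] := sheltered_exit sX cX uX cu.
    by have := ltn_trans bu uc; rewrite ltnn.
  by rewrite ltnNge (closest_le uP) ?inE in bu.
have ltX : #|[set y in X | dst y < dst u]| <
           #|[set y in X | dst y < dst (curr st)]|.
  apply/proper_card/properP; split.
    by apply/subsetP=> y; rewrite !inE => /andP[-> /ltn_trans->].
  by exists u; rewrite !inE uX ?ltnn ?uc.
split; first by rewrite free.1 free.2 // adj_sym.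
apply: IHk => //=.
- exact: leq_trans ltX _.
- by apply: spare_hop free _ _ _; rewrite // ltnW.
- exact: VG_nodes cu.
apply: leq_trans timeB; rewrite -addnA leq_add2l.
apply: leq_trans (_ : W * #|[set y in X | dst y < dst u]|.+1 <= _).
  by rewrite mulnS leq_add2r VG_dist.
by rewrite leq_mul2l ltX orbT.
Qed.

Lemma avail_free st d x v : spare st d -> adj VG x v -> dst v < d ->
  v \in avail_neigh VG q st x.
Proof.
by move=> [_ free] xv vd; apply/avail_neighP; rewrite free // adj_sym.
Qed.

(** The closest virtual neighbour is at least as close as some physical neighbour that approaches
    [e], so its link is still unspent and the physical fallback never fires. *)
Lemma greedy_next_closest st : spare st (dst (curr st)) -> curr st \in V ->
  curr st != e ->
  (exists u d, greedy_next Gph VG q e st u d) /\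
  (forall u d, greedy_next Gph VG q e st u d ->
     closest Gph e (neigh VG (curr st)) u).
Proof.
move=> [_ free] cV ce; have [p cp pc] := closer cV ce.
have pN : p \in neigh VG (curr st) by rewrite inE adj_VG.
have enough v : closest Gph e (neigh VG (curr st)) v ->
    (links st v (curr st) < q) = false.
  move=> vP; apply: negbTE; rewrite -leqNgt; apply: free.
    by have := closest_in vP; rewrite inE adj_sym.
  exact: leq_ltn_trans (closest_le vP pN) pc.
split=> [|u d [_ [v vP]]]; last by rewrite enough // => /eqP->.
have [v vP] := closest_ex Gph e pN.
by exists v, (best st); split=> //; exists v => //; rewrite enough //=.
Qed.

Lemma best_effort_ex st : curr st \in V -> curr st != e ->
  exists u, best_effort_choice Gph VG q e st u.
Proof.
move=> cV ce; have [p cp _] := closer cV ce.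
rewrite /best_effort_choice; case: eqP => [_|/eqP/set0Pn[u]]; last by exists u.
by apply: (@closest_ex _ _ _ _ p); rewrite inE.
Qed.

Lemma best_effort_closest st u v : best_effort_choice Gph VG q e st u ->
  v \in avail_neigh VG q st (curr st) -> dst v < dst (curr st) ->
  closest Gph e (avail_neigh VG q st (curr st)) u.
Proof.
rewrite /best_effort_choice => + vA vc; have [w wP] := closest_ex Gph e vA.
rewrite ifN => [|]; first by rewrite inE => /andP[].
apply/set0Pn; exists w; rewrite inE wP; exact: leq_ltn_trans (closest_le wP vA) vc.
Qed.

(** Filtering by availability discards only neighbours no closer to [e] than the current node, and a
    closer available neighbour always exists. *)
Lemma best_effort_next_closest st : spare st (dst (curr st)) -> curr st \in V ->
  curr st != e ->
  (exists u d, best_effort_next Gph VG q e st u d) /\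
  (forall u d, best_effort_next Gph VG q e st u d ->
     closest Gph e (neigh VG (curr st)) u).
Proof.
move=> free cV ce; split=> [|u d [_ uP]].
  by have [u uP] := best_effort_ex cV ce; exists u, (best st).
have [p /adj_VG cp pc] := closer cV ce; have pA := avail_free free cp pc.
have {}uP := best_effort_closest uP pA pc.
have /avail_neighP[cu _] := closest_in uP.
rewrite /closest inE cu; apply/forall_inP => w; rewrite inE => cw.
have [wc|cw'] := ltnP (dst w) (dst (curr st)).
  by apply: closest_le uP _; apply: avail_free free cw wc.
by rewrite (leq_trans _ cw') // (leq_trans _ (ltnW pc)) // (closest_le uP).
Qed.

(** * The NoN local best effort algorithm *)

Lemma non_loop_spec st order :
  let: (d, next) := non_loop Gph VG q e st order in
  [/\ d <= best st,
      forall u' w, u' \in order -> lookahead Gph VG q e st u' = Some w ->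
        d <= dst w
    & if next is Some u' then
        [/\ u' \in order, d < best st &
          exists2 w, lookahead Gph VG q e st u' = Some w & d = dst w]
      else d = best st].
Proof.
rewrite /non_loop; elim/last_ind: order => [|s u' IHs] //=.
rewrite foldl_rcons; case: (foldl _ _ s) IHs => d next [d_le d_min nextP].
case lookw: (lookahead _ _ _ _ _ u') => [w|] /=; last first.
  split=> // [v w|].
    by rewrite mem_rcons inE => /predU1P[->|/(d_min _ w) //]; rewrite lookw.
  by case: next nextP => // v [vs ? ?]; rewrite mem_rcons inE vs orbT.
case: ltnP => [wd|dw].
  split=> [|v w'|].
  - by rewrite (leq_trans _ d_le) // ltnW.
  - rewrite mem_rcons inE => /predU1P[->|vs /(d_min _ _ vs)].
      by rewrite lookw => -[->].
    by apply: leq_trans; apply: ltnW.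
  - by rewrite mem_rcons inE eqxx (leq_trans wd) //; split=> //; exists w.
split=> // [v w'|].
- rewrite mem_rcons inE => /predU1P[->|/(d_min _ w') //].
  by rewrite lookw => -[<-].
- by case: next nextP => // v [vs ? ?]; rewrite mem_rcons inE vs orbT.
Qed.

(* The current node is itself seen through u', so that the physical fallback is
   never taken. *)
Lemma lookahead_closest st u' :
  (forall x y, links st x y = links st y x) ->
  u' \in avail_neigh VG q st (curr st) ->
  exists2 w, lookahead Gph VG q e st u' = Some w &
             closest Gph e (avail_neigh VG q st u') w.
Proof.
move=> sym /avail_neighP[cu' qu'].
have cA : curr st \in avail_neigh VG q st u'.
  by apply/avail_neighP; rewrite adj_sym cu' sym.
rewrite /lookahead; case: pickP => [w wP|noA].
  by exists w => //; rewrite ltnNge (closest_le wP cA).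
by have [w wP] := closest_ex Gph e cA; rewrite noA in wP.
Qed.

(** The first case is a pass of the loop that improves [best]; the second is a pass that does not,
    which certifies that nothing available two hops away is closer than [best]. *)
Lemma non_nextP st u d :
  (forall x y, links st x y = links st y x) ->
  avail_neigh VG q st (curr st) != set0 ->
  non_next Gph VG q e st u d ->
  [/\ u \in avail_neigh VG q st (curr st), d < best st &
      exists2 w, closest Gph e (avail_neigh VG q st u) w & d = dst w] \/
  [/\ best_effort_choice Gph VG q e st u, d = best st &
      forall u' w, u' \in avail_neigh VG q st (curr st) ->
        w \in avail_neigh VG q st u' -> best st <= dst w].
Proof.
move=> sym A0 [order]; rewrite /non_candidates (negPf A0) => /perm_mem mem_ord.
have := non_loop_spec st order; case: (non_loop _ _ _ _ _ _) => d' [u'|].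
  case=> _ _ [u'o d'b [w lookw d'w]] [-> ->]; left.
  have u'A : u' \in avail_neigh VG q st (curr st).
    by rewrite -mem_enum -mem_ord.
  split=> //; have [w'] := lookahead_closest sym u'A.
  by rewrite lookw => -[<-]; exists w.
case=> _ d_min d'b [-> uP]; rewrite d'b in d_min *.
right; split=> // u' w u'A wA.
have [w' look_w' w'P] := lookahead_closest sym u'A.
apply: leq_trans (closest_le w'P wA).
by apply: d_min _ look_w'; rewrite mem_ord mem_enum.
Qed.

Lemma non_next_ex st : curr st \in V -> curr st != e ->
  exists u d, non_next Gph VG q e st u d.
Proof.
move=> cV ce; have [v vP] := best_effort_ex cV ce.
case E: (non_loop Gph VG q e st (enum (non_candidates Gph VG q st))) => [d [u|]].
- by exists u, d; exists (enum (non_candidates Gph VG q st)); rewrite // E.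
- by exists v, d; exists (enum (non_candidates Gph VG q st)); rewrite // E.
Qed.

(* After a hop that improved d, d is the least distance to e of a virtual
   neighbour of the current node. *)
Definition aimed (st : state T) : Prop :=
  [/\ spare st (best st).+1, best st < dst (curr st),
      exists2 v, adj VG (curr st) v & dst v = best st
    & forall v, adj VG (curr st) v -> best st <= dst v].

(** Neighbours of [u] at distance below [D] are all available, so [d] bounds them from below; the
    others are at distance at least [D > d]. Hence the lookahead value is a minimum over all virtual
    neighbours of [u]. *)
Lemma non_hop st u d D :
  best st < D -> d < best st -> spare st D ->
  best st <= dst (curr st) -> u \in avail_neigh VG q st (curr st) -> u \in V ->
  (exists2 w, closest Gph e (avail_neigh VG q st u) w & d = dst w) ->
  u = e \/ aimed (hop Gph q st u d).
Proof.
move=> bD db free bc /avail_neighP[cu qu] uV [w wP dw].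
have [|ue] := eqVneq u e; [by left|right].
have near_seen v : adj VG u v -> dst v < D -> d <= dst v.
  by move=> uv vD; rewrite dw (closest_le wP) // (avail_free free).
have du : d < dst u.
  have [p /adj_VG up pu] := closer uV ue.
  have [pD|Dp] := ltnP (dst p) D; last by lia.
  exact: leq_ltn_trans (near_seen p up pD) pu.
split=> //=.
- by apply: spare_hop free _ _ _; lia.
- by exists w => //; have /avail_neighP[] := closest_in wP.
- move=> v uv; have [vD|Dv] := ltnP (dst v) D; first exact: near_seen.
  by lia.
Qed.

(** The potential [M d] collects the nodes of [X] with a virtual neighbour at distance less than
    [d]. A hop to [u] lowers [d] to the least distance seen from [u], so [u] drops out of the set.
    The successor in the time bound pays for the last hop, into [e]. *)
Lemma non_aimed_latency B X st :
  sheltered X -> aimed st -> curr st \in V -> curr st \in X ->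
  clock st + W * (#|[set y in X | [exists z in neigh VG y, dst z < best st]]|).+1
    <= B ->
  latency_le Gph q e (non_next Gph VG q e) B st.
Proof.
move=> sX; set M := fun d => [set y in X | [exists z in neigh VG y, dst z < d]].
have [k] := ubnP #|M (best st)|.
elim: k st => // k IHk st ltXk aim cV cX timeB.
have [free bc [v cv vb] b_min] := aim.
have ce : curr st != e by apply: contraTneq bc => ->; rewrite distxx.
have vA : v \in avail_neigh VG q st (curr st).
  by apply: avail_free free cv _; rewrite vb.
have A0 : avail_neigh VG q st (curr st) != set0 by apply/set0Pn; exists v.
have vV := VG_nodes cv.
apply: latency_hop; [exact/eqP|exact: non_next_ex|].
move=> u d /(non_nextP free.1 A0)[[uA db uP]|[uP db no_better]].
  have /avail_neighP[cu qu] := uA; have uV := VG_nodes cu.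
  split; first by rewrite free.1.
  have [ue|aim'] := non_hop (ltnSn _) db free (ltnW bc) uA uV uP.
    apply: latency_done => //=; apply: leq_trans timeB.
    by rewrite leq_add2l mulnS (leq_trans (VG_dist cu)) // leq_addr.
  have [_ _ [w uw wd] _] := aim'; rewrite /= in uw wd.
  (* Were [u] outside [X], the current node or one of its neighbours would be at distance at most
     [d], contradicting the minimality of [best st]. *)
  have uX : u \in X.
    case: (boolP (u \in X)) => // uX.
    have [_ /(_ w uw)[b cb]] := sheltered_exit sX cX uX cu.
    have: best st <= dst b by case: cb => [->|/b_min //]; apply: ltnW.
    by rewrite wd; lia.
  have ltM : #|M d| < #|M (best st)|.
    apply/proper_card/properP; split.
      apply/subsetP=> y; rewrite !inE => /andP[-> /exists_inP[z yz zd]].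
      by apply/exists_inP; exists z => //; apply: ltn_trans db.
    exists u; rewrite !inE uX /=.
      by apply/exists_inP; exists w; rewrite ?inE // wd.
    have [_ _ _ d_min] := aim'.
    by apply/exists_inP => -[z]; rewrite inE => /d_min; rewrite /= leqNgt => /negP.
  apply: IHk => //=; first exact: leq_trans ltM _.
  apply: leq_trans timeB; rewrite -addnA leq_add2l [leqRHS]mulnS.
  by rewrite leq_add ?VG_dist // leq_mul2l ltM orbT.
(* Otherwise [v], at distance [best st], has a physical neighbour closer to [e], and looking ahead
   through [v] would have improved [best]. *)
have b0 : best st = 0.
  apply/eqP; rewrite -leqn0 leqNgt; apply/negP => b_gt0.
  have ve : v != e by apply: contraTneq b_gt0 => ve; rewrite -vb ve distxx.
  have [p /adj_VG vp pv] := closer vV ve.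
  have pA : p \in avail_neigh VG q st v.
    by apply: avail_free free vp _; rewrite -vb ltnS ltnW.
  by have := no_better v p vA pA; rewrite -vb leqNgt pv.
have {}uP := best_effort_closest uP vA; rewrite vb in uP.
have /avail_neighP[cu qu] := closest_in (uP bc).
split; first by rewrite free.1.
apply: latency_done => /=.
  by apply: (@dist_eq0 _ Gph); apply/eqP; rewrite -leqn0 -b0 -vb (closest_le (uP bc)).
apply: leq_trans timeB.
by rewrite leq_add2l mulnS (leq_trans (VG_dist cu)) // leq_addr.
Qed.

(** Initially [best] is the distance of the source itself, so the first hop may lead anywhere among
    the neighbours. The shelter is therefore taken around the node reached by that hop; of [K.+2]
    hops, one is this first hop and one the final hop into [e]. *)
Lemma non_latency B K st :
  (forall x, x \in V -> exists X : {set T}, [/\ x \in X, #|X| <= K & sheltered X]) ->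
  spare st (dst (curr st)).+1 -> best st = dst (curr st) -> curr st \in V ->
  clock st + W * K.+2 <= B ->
  latency_le Gph q e (non_next Gph VG q e) B st.
Proof.
move=> shelter free bc cV timeB.
have [ce|ce] := eqVneq (curr st) e.
  by apply: latency_done => //; apply: leq_trans timeB; apply: leq_addr.
have [p /adj_VG cp pc] := closer cV ce; have pV := VG_nodes cp.
have pA := avail_free free cp (ltnW pc).
have A0 : avail_neigh VG q st (curr st) != set0 by apply/set0Pn; exists p.
apply: latency_hop; [exact/eqP|exact: non_next_ex|].
move=> u d /(non_nextP free.1 A0)[[uA db uP]|[uP db no_better]].
  have /avail_neighP[cu qu] := uA; have uV := VG_nodes cu.
  split; first by rewrite free.1.
  have leW := VG_dist cu.
  have free' : spare st (best st).+1 by rewrite bc.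
  have [ue|aim] := non_hop (ltnSn _) db free' (eq_leq bc) uA uV uP.
    apply: latency_done => //=; apply: leq_trans timeB.
    by rewrite leq_add2l mulnS (leq_trans leW) // leq_addr.
  have [X [uX XK sX]] := shelter u uV.
  apply: (non_aimed_latency sX aim) => //=.
  apply: leq_trans timeB; rewrite -addnA leq_add2l [leqRHS]mulnS.
  rewrite leq_add // leq_mul2l ltnS (leq_trans _ XK) ?orbT //.
  by apply/subset_leq_card/subsetP=> y; rewrite inE => /andP[].
(* Without improvement, a physical neighbour [p] closer to [e] must be [e] itself, for otherwise a
   still closer node would be seen through [p]. *)
have pe : p = e.
  apply: contraTeq isT => pe; have [w /adj_VG pw wp] := closer pV pe.
  have wA : w \in avail_neigh VG q st p.
    by apply: avail_free free pw _; lia.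
  by have := no_better p w pA wA; rewrite bc leqNgt (ltn_trans wp pc).
have {}uP := best_effort_closest uP pA pc.
have /avail_neighP[cu qu] := closest_in uP.
split; first by rewrite free.1.
apply: latency_done => /=.
  apply: (@dist_eq0 _ Gph); apply/eqP; rewrite -leqn0.
  by rewrite (leq_trans (closest_le uP pA)) // pe distxx.
apply: leq_trans timeB.
by rewrite leq_add2l mulnS (leq_trans (VG_dist cu)) // leq_addr.
Qed.

Lemma latency_at_most_sheltered B (a : algorithm) (D : T -> T -> nat) cap s K :
  (forall x, x \in V -> exists X : {set T}, [/\ x \in X, #|X| <= K & sheltered X]) ->
  D s e = q -> q <= cap -> s \in V -> W * K.+2 <= B ->
  latency_at_most a Gph VG cap D s e B.
Proof.
move=> shelter Dq qcap sV leB; rewrite /latency_at_most Dq.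
set st := initial_state _ _ _ _ _.
(* Nothing is reserved yet: every virtual link carries [cap], which is at least [q]. *)
have free d : spare st d.
  by split=> [x y|x y xy _]; rewrite /= ?xy // adj_sym.
have [X [sX XK sh]] := shelter s sV.
have greedyB : clock st + W * #|[set y in X | dst y < dst (curr st)]| <= B.
  apply: leq_trans leB; rewrite add0n leq_mul2l ltnW ?orbT // ltnW // !ltnS.
  rewrite (leq_trans _ XK) //.
  by apply/subset_leq_card/subsetP=> y; rewrite inE => /andP[].
case: a => /=.
- exact: greedy_like_latency greedy_next_closest sh (free _) sV sX greedyB.
- exact: greedy_like_latency best_effort_next_closest sh (free _) sV sX greedyB.
- exact: non_latency shelter (free _) _ sV _.
Qed.

End Routing.

(** * Adjacency in an injective image of a graph *)

Section ImageEdges.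
Variables (K T : finType) (c : K -> T).
Hypothesis c_inj : injective c.

Lemma image_edges_adj (H : graph K) x y :
  x != y -> [set x; y] \in image_edges c (edges H) ->
  exists a b, [/\ x = c a, y = c b & adj H a b].
Proof.
move=> xy /imsetP[f fH xyf].
have /imsetP[a af xa] : x \in c @: f by rewrite -xyf set21.
have /imsetP[b bf yb] : y \in c @: f by rewrite -xyf set22.
exists a, b; split=> //; rewrite /adj; apply/andP; split.
  by apply: contra_neq xy; rewrite xa yb => ->.
rewrite (_ : [set a; b] = f) //; apply: (imset_inj c_inj).
by rewrite imsetU !imset_set1 -xa -yb.
Qed.

Lemma adj_image_edges (H : graph K) a b : adj H a b ->
  (c a != c b) && ([set c a; c b] \in image_edges c (edges H)).
Proof.
case/andP=> ab abH; rewrite (inj_eq c_inj) ab /=; apply/imsetP.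
by exists [set a; b]; rewrite // imsetU !imset_set1.
Qed.

End ImageEdges.

(** * Distances in the cycle *)

Section Cycle.
Variable n : nat.
Hypothesis n_gt1 : 1 < n.
Local Notation Cn := (cycle_graph n).

Lemma ordS_neq (i : 'I_n) : i != ordS i.
Proof.
apply/negP => /eqP/(congr1 val) /=; have := ltn_ord i.
rewrite leq_eqVlt => /predU1P[in_|/modn_small->]; last by lia.
by rewrite in_ modnn; lia.
Qed.

Lemma cycle_adj (i : 'I_n) : adj Cn i (ordS i).
Proof. by rewrite /adj ordS_neq; apply/imsetP; exists i. Qed.

Lemma cycle_walk t (i j : 'I_n) : i + t = j %[mod n] -> walk_le Cn t i j.
Proof.
elim: t i => [|t IHt] i ij.
  rewrite addn0 !modn_small // in ij.
  by rewrite (val_inj ij); apply: walk_le0.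
rewrite -add1n; apply: (walk_le_trans (walk_le1 (cycle_adj i))).
by apply: IHt; rewrite /= modnDml -ij addnS.
Qed.

Lemma cycle_walk_half (i j : 'I_n) : walk_le Cn (n %/ 2) i j.
Proof.
wlog ij : i j / i <= j.
  by move=> IH; have [/IH|/ltnW/IH/walk_le_sym] := leqP i j.
have jn := ltn_ord j.
have [le_half|lt_half] := leqP (j - i) (n %/ 2).
  by apply: walk_leW le_half _; apply: cycle_walk; rewrite subnKC.
(* The complementary arc runs from [j] forward through [n], back to [i]. *)
apply: walk_le_sym; apply: (@walk_leW _ _ (n - (j - i))); first by lia.
apply: cycle_walk; rewrite (_ : j + _ = i + n) ?modnDr //; lia.
Qed.

End Cycle.

(** * Physical and virtual edges through the successive substitutions *)

Section Substitution.
Variables (T : finType) (n : nat) (base : 'I_n -> T)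
  (copy : nat -> {set T} -> 'I_n -> T) (port : nat -> {set T} -> T -> 'I_n)
  (l : nat) (G : nat -> graph T) (VG0 : graph 'I_n).
Hypothesis n_gt1 : 1 < n.
Hypothesis Gl : rrgg base copy port l G.
Hypothesis cycle_VG0 : edges (cycle_graph n) \subset edges VG0.

Local Notation Cn := (cycle_graph n).
Local Notation S k := (subst_set n G k).
Local Notation V k := (nodes (G k)).
Local Notation VG k := (virtual_graph base copy port VG0 G k).

Lemma subst_set_pair k f : f \in S k ->
  exists x y, [/\ x != y, f = [set x; y] & f \in edges (G k)].
Proof.
case/bigcupP=> E /imsetP[c]; rewrite inE => /andP[/injectiveP c_inj /subsetP cE].
move=> -> fE; have := cE f fE; case/imsetP: fE => g /imsetP[i _ ->] ->.
rewrite imsetU !imset_set1 => fk; exists (c i), (c (ordS i)); split=> //.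
  by rewrite (inj_eq c_inj) ordS_neq.
by case: k {cE} fk => //= k; rewrite inE => /andP[].
Qed.

Lemma subst_set_adj k f x y : f \in S k -> x \in f -> y \in f -> x != y ->
  adj (G k) x y.
Proof.
case/subst_set_pair=> a [b [ab -> abk]]; rewrite !inE /adj.
by case/pred2P=> ->; case/pred2P=> ->; rewrite ?eqxx // => ->; rewrite ?abk // setUC.
Qed.

Section Step.
Variable k : nat.
Hypothesis kl : k < l.

Let valid : valid_subst (copy k) (port k) Cn (S k) (G k).
Proof. exact: rrgg_valid Gl _ kl. Qed.

Lemma nodesSP x :
  reflect (x \in V k \/ exists f i, f \in S k /\ x = copy k f i)
          (x \in V k.+1).
Proof.
rewrite (rrggS Gl kl) /=; apply: (iffP setUP).
  case=> [|/bigcupP[f fS /imsetP[i _ xi]]]; [by left|right].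
  by exists f, i.
case=> [|[f [i [fS ->]]]]; [by left|right].
by apply/bigcupP; exists f => //; apply: imset_f; rewrite inE.
Qed.

Lemma copyN_nodes f i : f \in S k -> copy k f i \notin V k.
Proof. exact: copy_new valid f i. Qed.

Lemma copyI f : f \in S k -> injective (copy k f).
Proof. exact: copy_inj valid f. Qed.

Lemma copy_eq f g i j : f \in S k -> g \in S k -> copy k f i = copy k g j ->
  f = g.
Proof.
move=> fS gS /eqP; apply: contraTeq => fg; exact: copy_disj valid _ _ _ _ fS gS fg.
Qed.

Lemma subst_adjP (H : graph 'I_n) x y : x != y ->
  [set x; y] \in subst_edges (copy k) (port k) H (S k) ->
  exists2 f, f \in S k &
    [\/ exists a b, [/\ x = copy k f a, y = copy k f b & adj H a b],
        x \in f /\ y = copy k f (port k f x)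
      | y \in f /\ x = copy k f (port k f y)].
Proof.
move=> xy /bigcupP[f fS /setUP[|/imsetP[u uf xyu]]].
  case/(image_edges_adj (copyI fS) xy) => a [b abP].
  by exists f => //; constructor 1; exists a, b.
exists f => //; have := xyu => /setP xyuP.
have := xyuP x; have := xyuP y; rewrite !inE !eqxx ?orbT /=.
move=> /esym/pred2P[yu|yc] /esym/pred2P[xu|xc].
- by rewrite yu xu eqxx in xy.
- by constructor 3; rewrite yu -xc.
- by constructor 2; rewrite xu -yc.
- by rewrite xc yc eqxx in xy.
Qed.

Lemma edgesS : edges (G k.+1) =
  edges (G k) :\: S k :|: subst_edges (copy k) (port k) Cn (S k).
Proof. by rewrite (rrggS Gl kl). Qed.

Lemma copy_walk f t a b : f \in S k -> walk_le Cn t a b ->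
  walk_le (G k.+1) t (copy k f a) (copy k f b).
Proof.
move=> fS; rewrite -[X in _ -> walk_le _ X _ _]mul1n; apply: walk_le_sub => a' b' ab.
apply: walk_le1; rewrite /adj; have /andP[-> abE] := adj_image_edges (copyI fS) ab.
by rewrite edgesS inE; apply/orP; right; apply/bigcupP; exists f; rewrite // inE abE.
Qed.

Lemma port_walk f u : f \in S k -> u \in f -> u \in V k ->
  walk_le (G k.+1) 1 u (copy k f (port k f u)).
Proof.
move=> fS uf uV; apply: walk_le1; rewrite /adj; apply/andP; split.
  by apply: contraTneq uV => ->; apply: copyN_nodes.
rewrite edgesS inE; apply/orP; right; apply/bigcupP; exists f => //.
by rewrite inE; apply/orP; right; apply/imsetP; exists u.
Qed.

End Step.

Lemma nodes_mono j k x : j <= k -> k <= l -> x \in V j -> x \in V k.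
Proof.
move=> jk; elim: k jk => [|k IHk]; first by rewrite leqn0 => /eqP->.
rewrite leq_eqVlt => /predU1P[->//|jk] kl xj.
by apply/nodesSP => //; left; apply: IHk => //; apply: ltnW.
Qed.

Lemma edges_virtual k : k <= l ->
  edges (G k) \subset virtual_edges base copy port VG0 G k.
Proof.
have sub0 (c : 'I_n -> T) : image_edges c (edges Cn) \subset image_edges c (edges VG0).
  exact: imsetS.
elim: k => [|k IHk] kl; first by rewrite (rrgg0 Gl); apply: (sub0 base).
rewrite edgesS //= setUSS //; last first.
  by apply/bigcupsP=> f fS; apply: bigcup_max fS _; apply/setSU/sub0.
by apply: subset_trans (IHk (ltnW kl)); apply: subsetDl.
Qed.

Lemma adj_virtual k x y : k <= l -> adj (G k) x y -> adj (VG k) x y.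
Proof. by move=> kl /andP[xy xyE]; rewrite /adj xy (subsetP (edges_virtual kl)). Qed.

Lemma virtual_mono j k x y : j <= k -> adj (VG j) x y -> adj (VG k) x y.
Proof.
elim: k => [|k IHk]; first by rewrite leqn0 => /eqP->.
rewrite leq_eqVlt => /predU1P[->//|/IHk{}IHk /IHk/andP[xy xyE]].
by rewrite /adj xy /= inE xyE.
Qed.

Lemma virtualSP k x y : k < l -> adj (VG k.+1) x y ->
  adj (VG k) x y \/
  exists2 f, f \in S k &
    [\/ exists a b, [/\ x = copy k f a, y = copy k f b & adj VG0 a b],
        x \in f /\ y = copy k f (port k f x)
      | y \in f /\ x = copy k f (port k f y)].
Proof.
move=> kl /andP[xy /setUP[xyE|]]; first by left; rewrite /adj xy.
by move/(subst_adjP kl xy); right.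
Qed.

Lemma virtual_nodes k x y : k <= l -> adj (VG k) x y -> x \in V k /\ y \in V k.
Proof.
elim: k x y => [|k IHk] x y kl.
  case/andP=> xy; case/(image_edges_adj (base_inj Gl) xy) => a [b [-> -> _]].
  by rewrite (rrgg0 Gl) /= !imset_f.
(* A substituted edge is physical, hence virtual, at stage [k], so the induction hypothesis applies
   to its endpoints. *)
have inS f u : f \in S k -> u \in f -> u \in V k.
  move=> fS uf; have [a [b [ab fab _]]] := subst_set_pair fS.
  have [v vf uv] : exists2 v, v \in f & u != v.
    have [ub|] := eqVneq u b; last by exists b; rewrite // fab set22.
    by exists a; rewrite ?fab ?set21 // ub eq_sym.
  have uvk := adj_virtual (ltnW kl) (subst_set_adj fS uf vf uv).
  by case: (IHk _ _ (ltnW kl) uvk).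
have newS f i : f \in S k -> copy k f i \in V k.+1.
  by move=> fS; apply/nodesSP => //; right; exists f, i.
have oldS u : u \in V k -> u \in V k.+1 by apply: nodes_mono.
case/(virtualSP kl) => [/(IHk _ _ (ltnW kl))[xk yk]|[f fS]].
  by rewrite !oldS.
case=> [[a [b [-> -> _]]]|[xf ->]|[yf ->]]; rewrite ?newS //.
- by rewrite oldS // (inS f).
- by rewrite (oldS y) // (inS f).
Qed.

Lemma subst_set_nodes k f u : k <= l -> f \in S k -> u \in f -> u \in V k.
Proof.
move=> kl fS uf; have [a [b [ab fab _]]] := subst_set_pair fS.
have ba : adj (VG k) a b.
  by apply: adj_virtual kl _; apply: (subst_set_adj fS); rewrite ?fab ?set21 ?set22.
have [ak bk] := virtual_nodes kl ba.
by move: uf; rewrite fab => /set2P[]->.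
Qed.

(* An edge that is substituted becomes a path made of two attaching edges and
   of half a cycle. *)
Lemma stretchS k x y t : k < l -> walk_le (G k) t x y ->
  walk_le (G k.+1) ((n %/ 2 + 2) * t) x y.
Proof.
move=> kl; apply: (@walk_le_sub _ _ _ _ id) => a b ab.
have [aV bV] := virtual_nodes (ltnW kl) (adj_virtual (ltnW kl) ab).
case: (boolP ([set a; b] \in S k)) => abS.
  have af := set21 a b; have bf := set22 a b.
  rewrite (_ : _ + 2 = 1 + n %/ 2 + 1); last by lia.
  apply: walk_le_trans (walk_le_sym (port_walk kl abS bf bV)).
  apply: (walk_le_trans (port_walk kl abS af aV)).
  exact/copy_walk/cycle_walk_half.
apply: (@walk_leW _ _ 1); first by rewrite addn2.
by apply: walk_le1; case/andP: ab => ab abE; rewrite /adj ab edgesS // !inE abS abE.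
Qed.

Lemma stretch k x y t : k <= l -> walk_le (G k) t x y ->
  walk_le (G l) ((n %/ 2 + 2) ^ (l - k) * t) x y.
Proof.
move: {-1}(l - k) (erefl (l - k)) => d; elim: d k t => [|d IHd] k t ld kl xy.
  by rewrite mul1n (_ : l = k) //; lia.
rewrite expnSr -mulnA; apply: IHd (stretchS _ xy); lia.
Qed.

(** A new node reaches an endpoint of the edge that it replaces along its copy and an attaching
    edge; old nodes stay connected by [stretchS]. *)
Lemma connected k x y : k <= l -> x \in V k -> y \in V k ->
  exists t, walk_le (G k) t x y.
Proof.
elim: k x y => [|k IHk] x y kl.
  rewrite (rrgg0 Gl) => /imsetP[a _ ->] /imsetP[b _ ->].
  exists (1 * (n %/ 2)).
  apply: (walk_le_sub (h := base) _ (cycle_walk_half n_gt1 a b)).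
  by move=> c d /(adj_image_edges (base_inj Gl)) cd; apply: walk_le1; rewrite /adj.
have anchor z : z \in V k.+1 -> exists2 u, u \in V k & exists t, walk_le (G k.+1) t z u.
  case/(nodesSP kl) => [zV|[f [i [fS ->]]]].
    by exists z => //; exists 0; apply: walk_le0.
  have [a [b [_ fab _]]] := subst_set_pair fS.
  have af : a \in f by rewrite fab set21.
  have aV := subst_set_nodes (ltnW kl) fS af.
  exists a => //; exists (n %/ 2 + 1).
  apply: walk_le_trans (walk_le_sym (port_walk kl fS af aV)).
  exact/copy_walk/cycle_walk_half.
case/anchor=> u uV [t1 xu] /anchor[v vV [t2 /walk_le_sym vy]].
have [t3 /(stretchS kl) uv] := IHk u v (ltnW kl) uV vV.
by eexists; apply: walk_le_trans xu (walk_le_trans uv vy).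
Qed.


(** A virtual edge spans at most [w] physical edges at the stage where it first appears, and each
    later substitution stretches them by at most [n %/ 2 + 2]. Positivity of [w] covers the
    attaching edges. *)
Lemma virtual_walk w k x y : 0 < w ->
  (forall a b, adj VG0 a b -> walk_le Cn w a b) -> k <= l -> adj (VG k) x y ->
  walk_le (G l) ((n %/ 2 + 2) ^ l * w) x y.
Proof.
move=> w0 VG0w.
have lift j : j <= l -> walk_le (G j) w x y ->
    walk_le (G l) ((n %/ 2 + 2) ^ l * w) x y.
  move=> jl /(stretch jl); apply: walk_leW.
  by rewrite leq_mul2r leq_pexp2l ?orbT ?leq_subr // addn2.
elim: k => [|k IHk] kl.
  case/andP=> xy; case/(image_edges_adj (base_inj Gl) xy) => a [b [xa yb ab]].
  apply: (lift 0 kl); rewrite xa yb -[w]mul1n.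
  apply: (walk_le_sub (h := base) _ (VG0w a b ab)).
  move=> c d /(adj_image_edges (base_inj Gl)) cd; apply: walk_le1.
  by rewrite (rrgg0 Gl) /adj.
case/(virtualSP kl) => [/(IHk (ltnW kl))//|[f fS]] fxy; apply: (lift k.+1 kl).
case: fxy => [[a [b [-> -> ab]]]|[xf ->]|[yf ->]].
- exact/copy_walk/VG0w.
- apply: walk_leW w0 (port_walk kl fS xf _).
  exact: (subst_set_nodes (ltnW kl) fS).
- apply: walk_leW w0 (walk_le_sym (port_walk kl fS yf _)).
  exact: (subst_set_nodes (ltnW kl) fS).
Qed.

(** * Gadgets: their boundary, disjointness and covering *)

(** This is the part of stage [j] grown from the edge [f] substituted at step [k]. A copy is
    absorbed as soon as its edge has one endpoint in the gadget, so that copies replacing attaching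
    edges are included. *)
Fixpoint gadget (k : nat) (f : {set T}) (j : nat) : {set T} :=
  if j is i.+1 then
    gadget k f i :|: \bigcup_(g in S i |
      ((i == k) && (g == f)) || ~~ [disjoint g & gadget k f i])
      [set copy i g x | x in [set: 'I_n]]
  else set0.

Lemma gadgetSP k f j x :
  reflect (x \in gadget k f j \/ exists g i, [/\ g \in S j, x = copy j g i &
             ((j == k) && (g == f)) || ~~ [disjoint g & gadget k f j]])
          (x \in gadget k f j.+1).
Proof.
apply: (iffP setUP) => [[|/bigcupP[g /andP[gS gP] /imsetP[i _ ->]]]|].
- by left.
- by right; exists g, i.
case=> [|[g [i [gS -> gP]]]]; [by left|right].
by apply/bigcupP; exists g; rewrite ?gS // imset_f ?inE.
Qed.

Lemma gadget_nodes k f j x : j <= l -> x \in gadget k f j -> x \in V j.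
Proof.
elim: j => [|j IHj] jl; first by rewrite inE.
case/gadgetSP => [/(IHj (ltnW jl))|[g [i [gS -> _]]]].
  exact: nodes_mono.
by apply/nodesSP => //; right; exists g, i.
Qed.

Lemma disjoint_set0r (g : {set T}) : [disjoint g & set0].
Proof. by apply/pred0P=> x; rewrite /= inE andbF. Qed.

Lemma gadget_early k f j : j <= k -> gadget k f j = set0.
Proof.
elim: j => // j IHj jk; have j_k := IHj (ltnW jk).
apply/setP=> x; rewrite in_set0; apply/negP=> /gadgetSP; rewrite j_k in_set0.
by case=> // -[g [i [_ _]]]; rewrite disjoint_set0r orbF ltn_eqF.
Qed.

Lemma gadget_fresh k f j x : j <= l -> x \in V k -> x \notin gadget k f j.
Proof.
elim: j => [|j IHj] jl xk; first by rewrite inE.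
have [jk|kj] := ltnP j k; first by rewrite gadget_early // inE.
apply/negP=> /gadgetSP[|[g [i [gS xg _]]]]; first exact/negP/IHj/xk/ltnW.
have := copyN_nodes jl i gS; rewrite -xg (nodes_mono kj (ltnW jl) xk) //.
Qed.

Lemma gadgetS_old k f j x : j < l -> x \in V j ->
  (x \in gadget k f j.+1) = (x \in gadget k f j).
Proof.
move=> jl xj; apply/gadgetSP/idP => [[//|[g [i [gS xg _]]]]|]; last by left.
by have := copyN_nodes jl i gS; rewrite -xg xj.
Qed.

Lemma gadgetS_copy k f j g i : j < l -> g \in S j ->
  (copy j g i \in gadget k f j.+1) =
    ((j == k) && (g == f)) || ~~ [disjoint g & gadget k f j].
Proof.
move=> jl gS; apply/gadgetSP/idP => [[|[h [i' [hS gh]]]]|gP].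
- by move/(gadget_nodes (ltnW jl)); rewrite (negPf (copyN_nodes jl i gS)).
- by rewrite (copy_eq jl gS hS gh).
- by right; exists g, i.
Qed.

Lemma gadget_mono k f i j x : i <= j -> x \in gadget k f i -> x \in gadget k f j.
Proof.
elim: j => [|j IHj]; first by rewrite leqn0 => /eqP->.
by rewrite leq_eqVlt => /predU1P[->//|/IHj{}IHj /IHj xj]; apply/gadgetSP; left.
Qed.

(** By induction on the stage. A copy is absorbed whole, so only its attaching edges matter: if its
    edge [g] is not [f], then [g] meets the gadget, and the other endpoint of [g] is adjacent to a
    gadget node, hence is in the gadget or in [f] by induction. *)
Lemma gadget_boundary k f j x y : j <= l -> adj (VG j) x y ->
  y \in gadget k f j -> x \in gadget k f j \/ x \in f.
Proof.
elim: j x y => [|j IHj] x y jl; first by rewrite inE.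
have meet g u : g \in S j -> u \in g -> (j == k) && (g == f) ||
    ~~ [disjoint g & gadget k f j] -> u \in gadget k f j \/ u \in f.
  move=> gS ug /orP[/andP[_ /eqP<-]|]; first by right.
  case/pred0Pn=> v /andP[/= vg vA].
  have [->|uv] := eqVneq u v; first by left.
  apply: (IHj u v (ltnW jl) _ vA).
  exact: (adj_virtual (ltnW jl) (subst_set_adj gS ug vg uv)).
have old u : u \in gadget k f j -> u \in gadget k f j.+1.
  exact: gadget_mono.
case/(virtualSP jl) => [xy|[g gS]].
  have [xj yj] := virtual_nodes (ltnW jl) xy.
  by rewrite !gadgetS_old //; apply: IHj (ltnW jl) xy.
case=> [[a [b [-> -> _]]]|[xg ->]|[yg ->]].
- by rewrite !gadgetS_copy //; left.
- by rewrite gadgetS_copy // => /(meet g x gS xg)[/old|]; [left|right].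
- rewrite gadgetS_copy // gadgetS_old ?(subst_set_nodes (ltnW jl) gS yg) // => yA.
  by left; apply/orP; right; apply/pred0Pn; exists y; rewrite /= yg.
Qed.

(** A copy common to both gadgets at a stage after their creation replaces an edge meeting both. If
    it meets them at different endpoints [u] and [v], then [v] is in the first gadget too, or in
    [f]; the latter is excluded because [f] is older than the second gadget. *)
Lemma gadget_disjoint k f f' j x : k < l -> j <= l -> f \in S k -> f' \in S k ->
  x \in gadget k f j -> x \in gadget k f' j -> f = f'.
Proof.
move=> kl + fS f'S; elim: j x => [|j IHj] x jl; first by rewrite inE.
have jl' := ltnW jl.
case: (boolP (x \in V j)) => [xj|xj]; first by rewrite !gadgetS_old //; apply: IHj.
case/gadgetSP => [/(gadget_nodes jl')|[g [i [gS -> gf]]]]; first by rewrite (negPf xj).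
rewrite gadgetS_copy // => gf'.
have [jk|jk] := eqVneq j k.
  move: gf gf'; rewrite !gadget_early ?jk // !eqxx /=.
  by rewrite disjoint_set0r !orbF => /eqP<- /eqP<-.
move: gf gf'; rewrite (negPf jk) /= => /pred0Pn[u /andP[/= ug uf]].
case/pred0Pn=> v /andP[/= vg vf'].
have [uv|uv] := eqVneq u v; first by apply: (IHj u jl' uf); rewrite uv.
have vu : adj (VG j) v u.
  by apply: (adj_virtual jl'); apply: (subst_set_adj gS vg ug); rewrite eq_sym.
have [vf|vf] := gadget_boundary jl' vu uf; first exact: (IHj v jl' vf vf').
have := gadget_fresh f' jl' (subst_set_nodes (ltnW kl) fS vf).
by rewrite vf'.
Qed.

Lemma gadget_cover j x : j <= l -> x \in V j ->
  x \in V 0 \/ exists k f i, [/\ k < j, f \in S k, x = copy k f i &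
                                 x \in gadget k f j].
Proof.
elim: j => [|j IHj] jl; first by left.
case/(nodesSP jl) => [/(IHj (ltnW jl))[|[k [f [i [kj fS xf xA]]]]]|].
- by left.
- right; exists k, f, i; split=> //; first exact: ltnW.
  exact: gadget_mono xA.
case=> f [i [fS ->]]; right; exists j, f, i; split=> //.
by rewrite gadgetS_copy // !eqxx.
Qed.

(** The endpoints of [f] remain neighbours although [f] is physically deleted, because virtual edges
    are never removed. *)
Lemma gadget_gate k f : k < l -> f \in S k -> gate (VG l) (gadget k f l) f.
Proof.
move=> kl fS; split=> [x y|x y xf yf]; first exact: gadget_boundary.
have [->|xy] := eqVneq x y; [by left|right].
apply: virtual_mono (ltnW kl) _; apply: adj_virtual (ltnW kl) _.
exact: subst_set_adj xf yf xy.
Qed.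

(** * Shelters and the number of their nodes *)

Definition shelter (e u : T) : {set T} :=
  [set y in V l | [forall k : 'I_l, [forall f in S k,
     (y \in gadget k f l) ==> (u \in gadget k f l) || (e \in gadget k f l)]]].

(** A node outside the shelter lies in a gadget avoiding both [u] and [e]; no node of the shelter
    belongs to that gadget. *)
Lemma shelter_sheltered e u : sheltered (VG l) e (shelter e u).
Proof.
move=> x y; rewrite !inE => /andP[xV /forallP xP] yN xy.
have [_ yV] := virtual_nodes (leqnn l) xy.
move: yN; rewrite yV /= negb_forall => /existsP[k].
rewrite negb_forall => /existsP[f]; rewrite !negb_imply negb_or.
case/and4P=> fS yA uA eA; exists (gadget k f l), f; split=> //.
  exact: gadget_gate.
apply: contra uA => xA; have /forall_inP/(_ f fS) := xP k.
by rewrite xA (negPf eA) orbF.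
Qed.

Lemma shelter_self e u : u \in V l -> u \in shelter e u.
Proof.
by move=> uV; rewrite inE uV; apply/forallP=> k; apply/forall_inP=> f _; apply/implyP=> ->.
Qed.

(** The cycle created at step [k] whose gadget contains [u], if any; [gadget_disjoint] makes the
    pick unambiguous. *)
Let ring (k : nat) (u : T) : {set T} :=
  if [pick f in S k | u \in gadget k f l] is Some f
  then [set copy k f i | i in [set: 'I_n]] else set0.

Lemma card_ring k u : #|ring k u| <= n.
Proof.
rewrite /ring; case: pickP => [f _|_]; last by rewrite cards0.
by apply: leq_trans (leq_imset_card _ _) _; rewrite cardsT card_ord.
Qed.

Lemma ring_copy k f i u : k < l -> f \in S k -> u \in gadget k f l ->
  copy k f i \in ring k u.
Proof.
move=> kl fS uA; rewrite /ring; case: pickP => [f' /andP[f'S uA']|/(_ f)].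
  by rewrite (gadget_disjoint kl (leqnn l) fS f'S uA uA') imset_f ?inE.
by rewrite fS uA.
Qed.

(** A sheltered node outside the base lies on the cycle it was created with, and the gadget of that
    cycle contains [u] or [e]. This leaves the base cycle and two rings for each of the [l]
    steps. *)
Lemma card_shelter e u : #|shelter e u| <= (l + l).+1 * n.
Proof.
pose U v := \bigcup_(k < l) ring k v.
have cardU v : #|U v| <= l * n.
  rewrite -[l in leqRHS]card_ord -sum_nat_const.
  apply: leq_trans (_ : \sum_(k < l) #|ring k v| <= _).
    rewrite /U; elim/big_rec2: _ => [|k c A _ cA]; first by rewrite cards0.
    by rewrite (leq_trans (leq_card_setU _ _)) // leq_add2l.
  by apply: leq_sum => k _; apply: card_ring.
have sub : shelter e u \subset V 0 :|: (U u :|: U e).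
  apply/subsetP=> y; rewrite inE => /andP[yV /forallP yP].
  have [y0|[k [f [i [kl fS yk yA]]]]] := gadget_cover (leqnn l) yV.
    by rewrite inE y0.
  rewrite inE; apply/orP; right.
  have /forall_inP/(_ f fS) := yP (Ordinal kl); rewrite yA /= => /orP[uA|eA].
    by apply/setUP; left; apply/bigcupP; exists (Ordinal kl); rewrite // yk ring_copy.
  by apply/setUP; right; apply/bigcupP; exists (Ordinal kl); rewrite // yk ring_copy.
apply: leq_trans (subset_leq_card sub) _.
apply: leq_trans (leq_card_setU _ _) _; rewrite mulSn leq_add //.
  by rewrite (rrgg0 Gl) (leq_trans (leq_imset_card _ _)) // cardsT card_ord.
by apply: leq_trans (leq_card_setU _ _) _; rewrite mulnDl leq_add.
Qed.

Lemma rrgg_latency w B (a : algorithm) (D : T -> T -> nat) cap s e :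
  0 < w -> (forall b c, adj VG0 b c -> walk_le Cn w b c) ->
  D s e <= cap -> s \in V l -> e \in V l ->
  (n %/ 2 + 2) ^ l * w * ((l + l).+1 * n).+2 <= B ->
  latency_at_most a (G l) (VG l) cap D s e B.
Proof.
move=> w0 VG0w Dcap sV eV leB.
apply: (latency_at_most_sheltered _ _ _ _ _ _ erefl Dcap sV leB).
- by move=> x y; apply: adj_virtual.
- by move=> x y /(virtual_nodes (leqnn l))[].
- move=> x xV xe; have [t xt] := connected (leqnn l) xV eV.
  exact: dist_step xt xe.
- by move=> x y xy; apply/dist_le_walk/(virtual_walk w0 VG0w (leqnn l)).
- move=> u uV; exists (shelter e u); split.
  + exact: shelter_self.
  + exact: card_shelter.
  + exact: shelter_sheltered.
Qed.

End Substitution.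

(** * Span of the links chosen by the three strategies *)

Section BaseLinks.
Variables (m r : nat).
Hypothesis n_gt1 : 1 < 2 ^ m.
Local Notation n := (2 ^ m).
Local Notation Cn := (cycle_graph n).

Lemma draw_prob_in (K : finType) (w : K -> rat) (A : {set K}) (t : seq K) z :
  draw_prob w A t != 0%R -> z \in t -> z \in A.
Proof.
elim: t A => //= y t IHt A; case: ifP => [yA|]; last by rewrite eqxx.
rewrite mulf_eq0 negb_or => /andP[_ /IHt{}IHt].
by rewrite inE => /predU1P[->//|/IHt]; rewrite inE => /andP[].
Qed.

(** In an outcome of positive probability every factor is nonzero, so each drawn node is in range,
    whatever the weights. *)
Lemma random_links_walk w (L : 'I_n -> {set 'I_n}) x z :
  random_links r w L -> z \in L x -> walk_le Cn (2 ^ r) x z.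
Proof.
case=> t t0 ->; rewrite inE => zt.
have : z \in in_range r x.
  apply: (@draw_prob_in _ (w x) _ (t x)) zt.
  by move: t0; rewrite lt0r => /andP[/prodf_neq0/(_ x isT)].
rewrite inE => /andP[_ xz]; apply: walk_leW xz _.
exact: walk_le_dist (cycle_walk_half n_gt1 x z).
Qed.

Lemma links_walk sg (L : 'I_n -> {set 'I_n}) x z :
  links_from sg r L -> z \in L x -> walk_le Cn (2 ^ r) x z.
Proof.
case: sg => /=; [move=> LP|exact: random_links_walk|exact: random_links_walk].
case/LP=> _ [i [y [j [_ _ /andP[_ jr] xz]]]].
have jr2 : 2 ^ j <= 2 ^ r by rewrite leq_pexp2l // (leq_trans jr) ?geq_minr.
case: xz => xz; apply: walk_leW jr2 _; last apply: walk_le_sym.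
all: exact: cycle_walk.
Qed.

Lemma base_virtual_walk sg (L : 'I_n -> {set 'I_n}) x z :
  links_from sg r L -> adj (base_virtual_graph L) x z ->
  walk_le Cn (2 ^ r) x z.
Proof.
move=> LP /andP[xz /setUP[xzC|/imset2P[a b _ bL xz_ab]]].
  by apply: (@walk_leW _ _ 1); rewrite ?expn_gt0 //; apply: walk_le1; rewrite /adj xz.
have ab := links_walk LP bL.
have : x \in [set a; b] by rewrite -xz_ab set21.
have : z \in [set a; b] by rewrite -xz_ab set22.
case/set2P=> -> /set2P[]-> //.
2: exact: walk_le_sym.
all: exact: walk_leW (leq0n _) (walk_le0 _ _).
Qed.

End BaseLinks.

(** * The latency bound *)

Theorem corollary2 (l r : nat) (hr : 0 < r) :
  exists C : nat,
  forall (m : nat), r <= m ->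
  forall (T : finType) (base : 'I_(2 ^ m) -> T)
    (copy : nat -> {set T} -> 'I_(2 ^ m) -> T)
    (port : nat -> {set T} -> T -> 'I_(2 ^ m))
    (G : nat -> graph T), rrgg base copy port l G ->
  forall (sg : strategy) (L : 'I_(2 ^ m) -> {set 'I_(2 ^ m)}),
    links_from sg r L ->
  forall (cap : nat), 1 <= cap ->
  forall (D : T -> T -> nat),
    (forall i j : T, i \in nodes (G l) -> j \in nodes (G l) ->
       D i j = 0 \/ D i j = 1) ->
    #|[set p : T * T | [&& p.1 \in nodes (G l), p.2 \in nodes (G l)
                         & D p.1 p.2 != 0]]| = 1 ->
  forall (s e : T), s \in nodes (G l) -> e \in nodes (G l) -> D s e <> 0 ->
  forall a : algorithm,
    latency_at_most a (G l)
      (virtual_graph base copy port (base_virtual_graph L) G l)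
      cap D s e (C * (2 ^ m %/ 2) ^ l.+1).
Proof.
(* With [h = n / 2 >= 1], each stretching factor [h + 2] is at most [3 * h], and the number of hops
   [(2 * l + 1) * n + 2] is at most [(4 * l + 4) * h]; [2 ^ r] is the span of a virtual link. *)
exists (3 ^ l * 2 ^ r * (4 * l + 4)) => m rm T base copy port G Gl sg L LP cap cap1.
move=> D D01 _ s e sV eV Dse a.
have m0 : 0 < m by apply: leq_trans rm.
have n1 : 1 < 2 ^ m by rewrite -{1}(expn0 2) ltn_exp2l.
apply: (rrgg_latency n1 Gl _ (w := 2 ^ r) _ _ _ _ sV eV) => //.
- exact: subsetUl.
- by rewrite expn_gt0.
- by move=> b c; apply: base_virtual_walk LP.
- by case: (D01 s e sV eV) => [|->].
rewrite -(prednK m0) expnS mulKn //.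
set h := 2 ^ m.-1; have h1 : 0 < h by rewrite expn_gt0.
have -> : 3 ^ l * 2 ^ r * (4 * l + 4) * h ^ l.+1 =
    (3 * h) ^ l * 2 ^ r * ((4 * l + 4) * h) by rewrite expnMn expnS; lia.
rewrite !leq_mul //; last by nia.
by case: (posnP l) => [->//|l_gt0]; rewrite leq_exp2r //; lia.
Qed.
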